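(* Let $m,n>1$ be integers such that $\mathbb{Z}_n$ is a $\mathbb{Z}_m$-module (equivalently, $n\mid m$). Then the graph $G_n(\mathbb{Z}_m)$ is a ring graph if and only if there exist pairwise distinct primes $p_1,p_2,p_3$ and positive integers $\alpha_1,\alpha_2,\beta_1$ (only those occurring in the respective item being relevant) such that one of the following holds: (1) $m=p_1^{\alpha_1}$, $n=p_1^{\beta_1}$ and $\beta_1\leq 4$; (2) $m=p_1^{\alpha_1}p_2^{\alpha_2}$, $n=p_1$ and $\alpha_2\leq 3$; (3) $m=p_1^{\alpha_1}p_2$, $n=p_1^{2}$; (4) $m=p_1^{\alpha_1}p_2p_3$, $n=p_1$; (5) $m=p_1p_2^{\alpha_2}$, $n=p_1p_2^{2}$ and $\alpha_2\in\{2,3\}$; (6) $m=p_1p_2p_3$, $n=p_1p_2$; (7) $m=p_1^{\alpha_1}p_2^{\alpha_2}$, $n=p_1p_2$ and $\alpha_1,\alpha_2\leq 3$; (8) $m=n=p_1p_2p_3$.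
   Context: $\mathbb{Z}_k$ denotes the ring (or additive group) of integers modulo $k$. For integers $m,n>1$, $\mathbb{Z}_n$ is a $\mathbb{Z}_m$-module (with the natural action) if and only if $n$ divides $m$. Let $I(\mathbb{Z}_m)^*$ be the set of all non-zero proper ideals of $\mathbb{Z}_m$. The $\mathbb{Z}_n$-intersection graph of $\mathbb{Z}_m$, denoted $G_n(\mathbb{Z}_m)$, is the simple graph with vertex set $I(\mathbb{Z}_m)^*$ in which two distinct vertices $I,J$ are adjacent if and only if $I\mathbb{Z}_n\cap J\mathbb{Z}_n\neq 0$. Ring graphs: let $G$ be a finite simple graph. A chord of a cycle $C$ of $G$ is an edge of $G$ joining two vertices of $C$ that are not adjacent in $C$. A cycle is primitive if it has no chords. $G$ has the primitive cycle property (PCP) if any two (distinct) primitive cycles intersect in at most one edge. The free rank $\mathrm{frank}(G)$ is the number of primitive cycles of $G$; the cycle rank is $\mathrm{rank}(G)=|E(G)|-|V(G)|+r$, where $r$ is the number of connected components of $G$. $G$ is called a ring graph if it satisfies one of the following conditions, which are known to be equivalent: (i) $\mathrm{rank}(G)=\mathrm{frank}(G)$; (ii) $G$ satisfies the PCP and $G$ does not contain a subdivision of $K_4$ as a subgraph. Here a subdivision of a graph is any graph obtained from it by replacing edges by paths. The graph with no vertices (which occurs when $m$ is prime) is allowed and counts as a ring graph. *)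

(* Defs.v *)
From HB Require Import structures.
From mathcomp Require Import all_boot all_order all_algebra.

Set Implicit Arguments.
Unset Strict Implicit.
Unset Printing Implicit Defensive.

Import GRing.Theory.

Record sgraph := SGraph {
  vertex :> finType;
  adj : rel vertex;
  adj_sym : symmetric adj;
  adj_irrefl : irreflexive adj
}.

Section Cycles.
Variable G : sgraph.

Definition edges : {set {set G}} :=
  [set [set u.1; u.2] | u : G * G & adj u.1 u.2].

Definition is_cycle (s : seq G) : bool :=
  [&& 2 < size s, uniq s & cycle (@adj G) s].

Definition cycle_edges (s : seq G) : {set {set G}} :=
  [set [set x; next s x] | x in s].

(** A cycle, as a subgraph of [G], is identified with its set of edges, so that
    it does not depend on a starting point or on a direction.  A sequence
    without repetition has length at most [#|G|]. *)
Definition cycles : {set {set {set G}}} :=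
  \bigcup_(k < #|G|.+1) [set cycle_edges t | t : k.-tuple G & is_cycle t].

Lemma cyclesP (C : {set {set G}}) :
  reflect (exists2 s, is_cycle s & C = cycle_edges s) (C \in cycles).
Proof.
apply: (iffP bigcupP) => [[k _ /imsetP[t]]|[s s_cyc ->]].
  by rewrite inE => t_cyc ->; exists t.
have/and3P[_ s_uniq _] := s_cyc.
have s_lt : size s < #|G|.+1 by rewrite ltnS -(card_uniqP s_uniq) max_card.
exists (Ordinal s_lt) => //.
by apply/imsetP; exists (in_tuple s); rewrite ?inE.
Qed.

Definition chord (C : {set {set G}}) (e : {set G}) : bool :=
  [&& e \in edges, e \subset cover C & e \notin C].

Definition primitive_cycles : {set {set {set G}}} :=
  [set C in cycles | [forall e, ~~ chord C e]].

Definition primitive_cycle_property : Prop :=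
  {in primitive_cycles &, forall C D, C != D -> #|C :&: D| <= 1}.

End Cycles.

(** [b x] is the branch vertex of [x : H], and [p x y] lists the inner vertices
    of the path of [G], from [b x] to [b y], replacing the edge [xy] of [H]. *)
Definition contains_subdivision (H G : sgraph) : Prop :=
  exists (b : H -> G) (p : H -> H -> seq G),
    [/\ injective b,
        forall x y, adj x y ->
          path (@adj G) (b x) (rcons (p x y) (b y)) && uniq (p x y),
        forall x y, adj x y -> p y x = rev (p x y),
        forall x y z, adj x y -> b z \notin p x y
      & forall x y x' y', adj x y -> adj x' y' ->
          [set x; y] != [set x'; y'] -> [disjoint p x y & p x' y']].

Lemma complete_sym k : symmetric (fun i j : 'I_k => i != j).
Proof. by move=> i j; rewrite eq_sym. Qed.

Lemma complete_irrefl k : irreflexive (fun i j : 'I_k => i != j).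
Proof. by move=> i; rewrite eqxx. Qed.

Definition complete_graph (k : nat) : sgraph :=
  SGraph (@complete_sym k) (@complete_irrefl k).

(** An equivalent definition found in the literature: the number
    [#|primitive_cycles G|] of primitive cycles is the cycle rank of [G]. *)
Definition ring_graph (G : sgraph) : Prop :=
  primitive_cycle_property G /\ ~ contains_subdivision (complete_graph 4) G.

Section IntersectionGraph.
Local Open Scope ring_scope.
Variables (R : finComNzRingType) (M : finLmodType R).

Definition nonzero_proper_ideal (I : {set R}) : bool :=
  [&& 0 \in I, 1 \notin I,
      [forall a, forall u in I, forall v in I, a * u + v \in I]
    & I != [set 0]].

Lemma nonzero_proper_idealP (I : {set R}) :
  reflect (idealr_closed I /\ I != [set 0]) (nonzero_proper_ideal I).
Proof.
apply: (iffP and4P) => [[I0 I1 /forallP Icl In0]|[[I0 I1 Icl] In0]].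
  split=> //; split=> // a u v uI vI.
  by have/forall_inP/(_ _ uI)/forall_inP/(_ _ vI) := Icl a.
split=> //; apply/forallP=> a; apply/forall_inP=> u uI; apply/forall_inP=> v vI.
exact: Icl.
Qed.

Definition ideal_vertex : finType := {I : {set R} | nonzero_proper_ideal I}.

(** The submodule [IM] of finite sums of products [a *: x] with [a] in [I]; as
    [I] is closed under sums, the terms with the same [x] can be collected. *)
Definition ideal_mul (I : {set R}) : {set M} :=
  [set \sum_(x : M) f x *: x | f : {ffun M -> R} in ffun_on (mem I)].

Lemma ideal_mulP (I : {set R}) (y : M) : nonzero_proper_ideal I ->
  y \in ideal_mul I <->
  exists2 s : seq (R * M), all (fun u => u.1 \in I) s
                         & y = \sum_(u <- s) u.1 *: u.2.
Proof.
case/nonzero_proper_idealP=> [[I0 _ Icl] _]; split=> [/imsetP[f fI ->]|[s sI ->]].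
  exists [seq (f x, x) | x <- index_enum M].
    by apply/allP=> _ /mapP[x _ ->] /=; move/ffun_onP: fI; apply.
  by rewrite big_map.
have ID (u v : R) : u \in I -> v \in I -> u + v \in I.
  by move=> uI vI; rewrite -[u]mul1r Icl.
apply/imsetP; exists [ffun x => \sum_(u <- s | u.2 == x) u.1].
  apply/ffun_onP=> x; rewrite ffunE big_seq_cond.
  by apply: (big_ind (fun u => u \in I)) => // u /andP[/(allP sI)].
under [RHS]eq_bigr => x _ do rewrite ffunE scaler_suml big_mkcond.
rewrite exchange_big /=; apply: eq_bigr => u _.
by rewrite (bigD1 u.2) //= eqxx big1 ?addr0 // => x /negPf; rewrite eq_sym => ->.
Qed.

Definition intersection_adj : rel ideal_vertex := fun I J =>
  (I != J) && (ideal_mul (val I) :&: ideal_mul (val J) != [set 0]).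

Lemma intersection_adj_sym : symmetric intersection_adj.
Proof. by move=> I J; rewrite /intersection_adj eq_sym setIC. Qed.

Lemma intersection_adj_irrefl : irreflexive intersection_adj.
Proof. by move=> I; rewrite /intersection_adj eqxx. Qed.

Definition intersection_graph : sgraph :=
  SGraph intersection_adj_sym intersection_adj_irrefl.

End IntersectionGraph.

Section NaturalAction.
Local Open Scope ring_scope.

(** The class of [k] acts on [x] by [k x]; [a : 'Z_m] coerces to its
    representative in [0, m). *)
Definition natural_action (m n : nat) (a : 'Z_m) (x : 'Z_n) : 'Z_n := x *+ a.

Definition is_natural_module (m n : nat) : Prop :=
  let act := @natural_action m n in
  [/\ forall a b x, act a (act b x) = act (a * b) x,
      left_id 1 act,
      right_distributive act +%R
    & forall x, {morph act^~ x : a b / a + b}].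

Lemma is_natural_moduleP (m n : nat) :
  (1 < m)%N -> (1 < n)%N -> is_natural_module m n <-> (n %| m)%N.
Proof.
move=> m1 n1; split=> [[_ _ _ actD]|n_m].
  have valN1 : (-1 : 'Z_m) = m.-1 :> nat.
    by rewrite /= !modn_small Zp_cast ?subn1 // prednK // ltnW.
  have val1 : (1 : 'Z_m) = 1%N :> nat by rewrite /= modn_small // Zp_cast.
  have := actD 1 (-1) 1.
  rewrite addNr /natural_action valN1 val1 -mulrnDr addn1 prednK ?(ltnW m1) //.
  by move/(congr1 val); rewrite /= val_Zp_nat // => /esym/eqP.
have mulr_mod (x : 'Z_n) k : x *+ (k %% m) = x *+ k.
  have xm : x *+ m = 0.
    have/dvdnP[q ->] := n_m.
    by rewrite -mulr_natr natrM pchar_Zp // mulr0 mulr0.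
  by rewrite [in RHS](divn_eq k m) mulrnDr mulnC mulrnA xm mul0rn add0r.
have valD (a b : 'Z_m) : a + b = ((a + b) %% m)%N :> nat.
  by congr (_ %% _)%N; apply: Zp_cast.
have valM (a b : 'Z_m) : a * b = ((a * b) %% m)%N :> nat.
  by congr (_ %% _)%N; apply: Zp_cast.
have val1 : (1 : 'Z_m) = 1%N :> nat by rewrite /= modn_small // Zp_cast.
split=> [a b x|x|a x y|x a b]; rewrite /natural_action.
- by rewrite valM mulr_mod mulnC mulrnA.
- by rewrite val1.
- exact: mulrnDl.
- by rewrite valD mulr_mod mulrnDr.
Qed.

End NaturalAction.

Definition Zn_module (m n : nat) (h : is_natural_module m n) : Type := 'Z_n.

Section ZnModule.
Variables (m n : nat) (h : is_natural_module m n).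

HB.instance Definition _ := Finite.on (Zn_module h).
HB.instance Definition _ := GRing.Zmodule.on (Zn_module h).

Let actA := let: And4 p _ _ _ := h in p.
Let act1 := let: And4 _ p _ _ := h in p.
Let actDr := let: And4 _ _ p _ := h in p.
Let actDl := let: And4 _ _ _ p := h in p.

HB.instance Definition _ :=
  GRing.Zmodule_isLmodule.Build 'Z_m (Zn_module h) actA act1 actDr actDl.

End ZnModule.

(* Main.v *)
Require Import Defs.
From mathcomp Require Import all_boot all_order all_algebra zify.

Set Implicit Arguments.
Unset Strict Implicit.
Unset Printing Implicit Defensive.

Import GRing.Theory.

(** The vertices of the graph are the ideals [d Z_m] for the divisors [d] of
    [m] other than [1] and [m].  Call a prime [q] dividing [n] deficient for
    [d] when the [q]-part of [n] does not divide [d].  As [I Z_n] and [J Z_n]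
    meet in the multiples of the least common multiple of the generators, two
    distinct vertices are adjacent exactly when they have a common deficient
    prime ([intersection_adjE]).  So the ideals for which a given [q] is
    deficient form a clique, and counting divisors gives its size
    ([card_deficient_ideals]): with [b] the exponent of [q] in [n] and [m'] the
    largest divisor of [m] prime to [q], it is [b] times the number of divisors
    of [m'], minus one for the excluded divisor [1].

    In a ring graph no clique has four vertices, since these would be a
    subdivision of [K_4].  Hence every count [b * size (divisors m')] is at
    most [4].

    This necessary condition is also sufficient.  It leaves at most three
    primes dividing [n], and then the graph can be dismantled by repeatedly
    removing a vertex whose neighbours are at most two and pairwise adjacent
    ([label_elimination]): first the vertices with at most one deficient prime,
    whose neighbours lie in a single clique; the others pairwise share a prime
    because two of them have at least four deficient primes out of three, and
    there are at most three of them.  A graph that can be dismantled in this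
    way is a ring graph ([elimination_ring_graph]).  Indeed a cycle of length
    at least four has a chord next to the vertex of the cycle that is removed
    first, so the primitive cycles are triangles, and two triangles with two
    common edges are equal; and the first vertex of a subdivision of [K_4] to
    be removed cannot be a branch vertex, whose degree is three, while an inner
    vertex of a path can be bypassed through its two neighbours, so that the
    subdivision survives until no vertex is left.

    It remains to solve, for all primes [q] dividing [n], the inequalities
    [b * size (divisors m') <= 4]: the number [m'] has at most four divisors,
    so it is [1], a prime power or a product of two primes
    ([size_divisors_le4]), and a discussion of these cases gives the eight
    families. *)

(** * Graphs with an elimination order *)

Section Elimination.
Variable G : sgraph.
Implicit Types (A : {set G}) (v : G) (s : seq G).

Definition neighbours A v : {set G} := [set x in A | adj v x].

(** In the subgraph induced by [A], the vertex [v] is simplicial of degree at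
    most two. *)
Definition eliminable A v : Prop :=
  #|neighbours A v| <= 2 /\
  {in neighbours A v &, forall x y, x != y -> adj x y}.

(** Asking for an eliminable vertex in every set of vertices, rather than for
    one order of all vertices, gives at once the vertex of a cycle or of a
    subdivision that is removed first. *)
Definition elimination_graph : Prop :=
  forall A, A != set0 -> exists2 v, v \in A & eliminable A v.

Lemma cycle_edges_rot k s : uniq s -> cycle_edges (rot k s) = cycle_edges s.
Proof.
move=> s_uniq; apply/setP=> e; apply/imsetP/imsetP=> -[x];
  move=> xs ->; exists x.
- by move: xs; rewrite mem_rot.
- by rewrite next_rot.
- by rewrite mem_rot.
- by rewrite next_rot.
Qed.

Lemma mem_cover_cycle s x : x \in s -> x \in cover (cycle_edges s).
Proof.
move=> xs; apply/bigcupP; exists [set x; next s x]; last by rewrite !inE eqxx.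
by apply/imsetP; exists x.
Qed.

Lemma set2_eqP (T : finType) (a b c d : T) :
  reflect (a = c /\ b = d \/ a = d /\ b = c) ([set a; b] == [set c; d]).
Proof.
apply: (iffP eqP) => [E|[][-> ->]]; last first.
- by rewrite setUC.
- by [].
- have: [/\ a \in [set c; d], b \in [set c; d],
           c \in [set a; b] & d \in [set a; b]].
    by rewrite E !set21 !set22 -E !set21 !set22.
  by case=> /set2P[]? /set2P[]? /set2P[]? /set2P[]?;
    first [left; split; congruence | right; split; congruence].
Qed.

(** The two neighbours on the cycle of its eliminable vertex [v] are adjacent,
    and as the cycle is longer than a triangle the edge joining them is not one
    of its edges. *)
Lemma cycle4_chord s : elimination_graph -> is_cycle s -> 3 < size s ->
  exists e, chord (cycle_edges s) e.
Proof.
move=> elimG /and3P[_ s_uniq s_cyc] s4.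
have [|v vs [_ nbr_adj]] := elimG [set x in s].
  case: s s4 {s_uniq s_cyc} => // x s _.
  by apply/set0Pn; exists x; rewrite !inE eqxx.
rewrite inE in vs.
have [k t def_s] := rot_to vs.
rewrite -(cycle_edges_rot k s_uniq).
have: cycle (@adj G) (rot k s) by rewrite rot_cycle.
have: uniq (rot k s) by rewrite rot_uniq.
have: size (rot k s) > 3 by rewrite size_rot.
have: {in neighbours [set x in rot k s] v &, forall x y, x != y -> adj x y}.
  by move=> x y; rewrite !inE !mem_rot => xs ys; apply: nbr_adj; rewrite !inE.
rewrite def_s; case: t {def_s} => [|a [|b [|c t]]] //.
move=> {}nbr_adj _ {}s_uniq {}s_cyc.
set r := [:: v, a, b, c & t] in nbr_adj s_uniq s_cyc *.
have [[va vb vc] [ab ac] bc] :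
    [/\ [/\ v != a, v != b & v != c], a != b /\ a != c & b != c].
  move: s_uniq; rewrite /r /= !inE !negb_or.
  by case/and4P=> /and4P[-> -> -> _] /and3P[-> -> _] /andP[-> _] _.
have vr : v \in r by rewrite inE eqxx.
have next_v : next r v = a by rewrite /r /= eqxx.
have next_a : next r a = b by rewrite /r /= eq_sym (negPf va) eqxx.
have next_b : next r b = c.
  by rewrite /r /= !(eq_sym b) (negPf vb) (negPf ab) eqxx.
set z := prev r v.
have zr : z \in r by rewrite mem_prev.
have next_z : next r z = v by rewrite next_prev.
have az : a != z by apply: contraNneq vb => E; rewrite -next_z -E next_a.
have bz : b != z by apply: contraNneq vc => E; rewrite -next_z -E next_b.
have ar : a \in r by rewrite !inE eqxx orbT.
have az_adj : adj a z.
  apply: nbr_adj => //; rewrite in_set in_set ?ar ?zr /=.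
    by rewrite -[X in adj v X]next_v next_cycle.
  by rewrite adj_sym; apply: prev_cycle.
exists [set a; z]; apply/and3P; split.
- by apply/imsetP; exists (a, z); rewrite ?inE.
- by rewrite subUset !sub1set !mem_cover_cycle.
- apply/negP=> /imsetP[x _ /eqP/set2_eqP[][ax]].
    by rewrite -ax next_a => zb; rewrite zb eqxx in bz.
  by move=> zx; move: va; rewrite ax -zx next_z eqxx.
Qed.

(** Two edges of a triangle span it, so distinct triangles cannot share two
    edges: the property holds as soon as every primitive cycle is a triangle. *)
Lemma elimination_PCP : elimination_graph -> primitive_cycle_property G.
Proof.
move=> elimG.
have triangle C : C \in primitive_cycles G ->
    exists2 V : {set G},
      #|V| = 3 & C = [set g : {set G} | g \subset V & #|g| == 2].
  rewrite inE => /andP[/cyclesP[s s_cyc ->] /forallP noch].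
  have [/(cycle4_chord elimG s_cyc)[e ch]|] := ltnP 3 (size s).
    by have:= noch e; rewrite ch.
  case/and3P: s_cyc => s3 s_uniq _ s3'.
  case: s s3 s3' s_uniq {noch} => [|x [|y [|z [|]]]] // _ _.
  rewrite /= !inE negb_or => /and3P[/andP[xy xz] yz _].
  have nx : next [:: x; y; z] x = y by rewrite /= eqxx.
  have ny : next [:: x; y; z] y = z by rewrite /= eq_sym (negPf xy) eqxx.
  have nz : next [:: x; y; z] z = x.
    by rewrite /= !(eq_sym z) (negPf xz) (negPf yz) eqxx.
  exists [set x; y; z].
    by rewrite -setUA cardsU1 !inE negb_or xy xz cards2 yz.
  apply/setP=> g; rewrite inE; apply/imsetP/idP.
    case=> t; rewrite !inE => /or3P[]/eqP-> ->;
      rewrite ?nx ?ny ?nz cards2 ?xy ?yz ?(eq_sym z) ?xz subUset !sub1set;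
      by rewrite !inE !eqxx ?orbT.
  case/andP=> gV /cards2P[a [b [ab def_g]]].
  move: gV; rewrite def_g subUset !sub1set.
  rewrite !inE -!orbA => /andP[/or3P[]/eqP Ea /or3P[]/eqP Eb];
    rewrite ?Ea ?Eb ?eqxx // in ab *;
    first [by exists x; rewrite ?nx // !inE eqxx ?orbT
          |by exists y; rewrite ?ny // !inE eqxx ?orbT
          |by exists z; rewrite ?nz // !inE eqxx ?orbT
          |by exists x; rewrite ?nx 1?setUC // !inE eqxx ?orbT
          |by exists y; rewrite ?ny 1?setUC // !inE eqxx ?orbT
          |by exists z; rewrite ?nz 1?setUC // !inE eqxx ?orbT].
have span C e f : C \in primitive_cycles G -> e \in C -> f \in C -> e != f ->
    C = [set g : {set G} | g \subset e :|: f & #|g| == 2].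
  move=> /triangle[V V3 ->]; rewrite !inE.
  move=> /andP[eV /eqP e2] /andP[fV /eqP f2] ef.
  suff -> : e :|: f = V by [].
  apply/eqP; rewrite eqEcard subUset eV fV V3 ltnNge; apply: contra ef => ef2.
  have -> : e = e :|: f by apply/eqP; rewrite eqEcard subsetUl e2.
  by rewrite eq_sym eqEcard subsetUr f2.
move=> C D Cprim Dprim; apply: contraNT; rewrite -ltnNge.
case/card_gt1P=> e [f []]; rewrite !inE => /andP[eC eD] /andP[fC fD] ef.
by rewrite (span C e f) // -(span D e f).
Qed.

(** The set [A] is there for an induction on its cardinal: each elimination step
    confines the subdivision to a smaller set. *)
Definition K4_subdivision_in A (b : 'I_4 -> G) (p : 'I_4 -> 'I_4 -> seq G) :=
  [/\ injective b,
      forall x y, x != y ->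
        path (@adj G) (b x) (rcons (p x y) (b y)) && uniq (p x y),
      forall x y, x != y -> p y x = rev (p x y),
      forall x y z, x != y -> b z \notin p x y
    & forall x y x' y', x != y -> x' != y' ->
        [set x; y] != [set x'; y'] -> [disjoint p x y & p x' y']] /\
  ((forall x, b x \in A) /\ forall x y, x != y -> {subset p x y <= A}).

(** The three paths that leave a branch vertex begin with distinct vertices,
    because two paths share no inner vertex and no branch vertex is an inner
    vertex. *)
Lemma branch_vertex_degree A b p x :
  K4_subdivision_in A b p -> 2 < #|neighbours A (b x)|.
Proof.
move=> [[b_inj p_path p_rev b_p p_disj] [bA pA]].
pose first y := head (b y) (p x y).
have first_inj : {in [set~ x] &, injective first}.
  move=> y z; rewrite !inE ![_ == x]eq_sym => xy xz; rewrite /first.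
  have := (b_p x y z xy, b_p x z y xz, p_disj x y x z xy xz).
  case py: (p x y) => [|h t]; case pz: (p x z) => [|h' t'] /= [[bz bY] disj] E.
  - exact: b_inj.
  - by rewrite E inE eqxx in bY.
  - by rewrite E inE eqxx in bz.
  - apply: contraTeq (mem_head h t) => yz; rewrite -E in disj.
    apply/negbT/(disjointFl (disj _) (mem_head h t')).
    apply/set2_eqP=> -[][]; first by move=> _ /eqP; rewrite (negPf yz).
      by move=> xz'; rewrite xz' eqxx in xz.
have card3 : 2 < #|first @: [set~ x]|.
  by rewrite card_in_imset // cardsC1 card_ord.
apply: leq_trans card3 _.
apply/subset_leq_card/subsetP=> u /imsetP[y]; rewrite !inE eq_sym => xy -> {u}.
have /andP[] := p_path x y xy; have := pA x y xy; rewrite /first.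
by case: (p x y) => [|h t] sub /=; rewrite ?bA ?sub ?mem_head //= => /andP[->].
Qed.

(** Having degree at most two, [v] is no branch vertex; if it is an inner vertex
    of a path, its two neighbours there are adjacent, so that the path remains a
    path when [v] is left out. *)
Lemma K4_subdivision_shrink A b p v : v \in A -> eliminable A v ->
  K4_subdivision_in A b p ->
  K4_subdivision_in (A :\ v) b (fun x y => [seq u <- p x y | u != v]).
Proof.
move=> vA [v_le2 v_clique] sub; have := sub.
case=> [[b_inj p_path p_rev b_p p_disj] [bA pA]].
have b_v x : b x != v.
  apply: contraTneq v_le2 => <-.
  by rewrite -ltnNge (branch_vertex_degree x sub).
split; last first.
  split=> [x|x y xy u]; first by rewrite !inE b_v bA.
  by rewrite mem_filter !inE => /andP[-> /pA]; apply.
split=> //.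
- move=> x y xy; have /andP[xy_path p_uniq] := p_path x y xy.
  rewrite filter_uniq // andbT.
  have [vp|v_p] := boolP (v \in p x y); last first.
    rewrite (_ : filter _ _ = p x y) //; apply/all_filterP/allP=> u up.
    by apply: contraNneq v_p => <-.
  have uniq_xy : uniq (b x :: rcons (p x y) (b y)).
    rewrite /= mem_rcons inE rcons_uniq negb_or !b_p // p_uniq.
    by rewrite (inj_eq b_inj) xy.
  have subA : {subset b x :: rcons (p x y) (b y) <= A}.
    move=> u; rewrite inE mem_rcons inE => /or3P[/eqP->|/eqP->|] //; exact: pA.
  case/splitPr: vp xy_path uniq_xy subA p_uniq => p1 p2.
  rewrite filter_cat /= eqxx rcons_cat /= => xy_path uniq_xy subA p_uniq.
  have v12 : (v \notin p1) && (v \notin p2).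
    move: p_uniq; rewrite uniq_catC /= mem_cat negb_or andbC.
    by case/andP=> _ /andP[-> ->].
  have filt q : v \notin q -> [seq u <- q | u != v] = q.
    by move=> vq; apply/all_filterP/allP=> u uq; apply: contraNneq vq => <-.
  case/andP: v12 => /filt-> /filt->.
  rewrite rcons_cat cat_path; move: xy_path; rewrite cat_path /=.
  case/and3P=> -> uv; set u := last _ _ in uv *.
  case def_q: (rcons p2 (b y)) => [|w q].
    by case: p2 def_q {subA uniq_xy p_uniq}.
  rewrite def_q in uniq_xy subA; rewrite /= => /andP[vw ->]; rewrite andbT.
  have uq : u \in b x :: p1 by exact: mem_last.
  apply: v_clique.
  - by rewrite inE adj_sym uv subA // -cat_cons mem_cat uq.
  - by rewrite inE vw subA // -cat_cons mem_cat !inE eqxx !orbT.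
  - have : uniq ((b x :: p1) ++ [:: v, w & q]) by [].
    rewrite cat_uniq => /and3P[_ /hasPn nuq _].
    have:= nuq w; rewrite !inE eqxx orbT => /(_ isT).
    by apply: contraNneq => <-.
- by move=> x y xy; rewrite p_rev // filter_rev.
- by move=> x y z xy; rewrite mem_filter negb_and (b_p _ _ _ xy) orbT.
- move=> x y x' y' xy xy' E; have := p_disj _ _ _ _ xy xy' E.
  by apply: disjointW; apply/subsetP=> u; rewrite mem_filter => /andP[].
Qed.

Lemma elimination_no_K4_subdivision :
  elimination_graph -> ~ contains_subdivision (complete_graph 4) G.
Proof.
move=> elimG [b [p sub]].
suff no_sub k A : #|A| <= k -> forall p, ~ K4_subdivision_in A b p.
  apply: (no_sub #|G| setT (max_card _) p); split; first exact: sub.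
  by split=> [x|x y _ u _]; rewrite inE.
elim: k A => [|k IHk] A Ak {sub}p sub; have bA := sub.2.1 ord0.
  by move: Ak; rewrite leqn0 cards_eq0 => /eqP A0; rewrite A0 inE in bA.
have [|v vA v_elim] := elimG A; first by apply/set0Pn; exists (b ord0).
apply: IHk (K4_subdivision_shrink vA v_elim sub).
by move: Ak; rewrite (cardsD1 v) vA.
Qed.

Lemma elimination_ring_graph : elimination_graph -> ring_graph G.
Proof.
by split; [apply: elimination_PCP | apply: elimination_no_K4_subdivision].
Qed.

(** Four vertices of a clique, joined by paths without inner vertices, are a
    subdivision of [K_4]. *)
Lemma ring_graph_clique_le3 A : ring_graph G ->
  {in A &, forall x y, x != y -> adj x y} -> #|A| <= 3.
Proof.
move=> [_ noK4] A_clique; rewrite leqNgt; apply/negP=> A4; apply: noK4.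
pose b (i : 'I_4) : G := enum_val (widen_ord A4 i).
have b_inj : injective b by move=> i j /enum_val_inj/(congr1 val)/= /val_inj.
exists b, (fun _ _ => [::]); split=> //=.
- move=> x y xy; rewrite !andbT.
  by apply: A_clique; rewrite ?enum_valP // (inj_eq b_inj).
- by move=> x y x' y' _ _ _; apply/pred0P.
Qed.

End Elimination.

(** * Intersection graphs of sets of labels *)

Section LabelledGraph.
Variables (G : sgraph) (T : finType) (S : G -> {set T}).
Hypothesis adjE : forall x y : G, adj x y = (x != y) && (S x :&: S y != set0).

Definition label_class i : {set G} := [set x | i \in S x].

Lemma label_class_clique i :
  {in label_class i &, forall x y, x != y -> adj x y}.
Proof.
move=> x y; rewrite !inE adjE => ix iy ->.
by apply/set0Pn; exists i; rewrite inE ix.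
Qed.

(** A vertex with at most one label has its neighbours in one class, a clique
    with at most two other vertices.  When only vertices with two or three
    labels remain, any two of them have a common label; each class contains at
    most two of them, since it also has a vertex with a single label, so that
    counting pairs of a vertex and a label shows that at most three remain. *)
Lemma label_elimination :
    #|T| <= 3 -> (forall i, #|label_class i| <= 3) ->
    (1 < #|T| -> forall i, exists x, S x = [set i]) ->
  elimination_graph G.
Proof.
move=> T3 class3 single A /set0Pn[v0 v0A].
have nbr_le2 (B : {set G}) v : v \in B -> #|B| <= 3 ->
    neighbours A v \subset B -> #|neighbours A v| <= 2.
  move=> vB B3 sub; rewrite -ltnS; apply: leq_trans B3; apply: proper_card.
  by apply/properP; split=> //; exists v; rewrite // inE adj_irrefl andbF.
have [/exists_inP[v vA Sv1]|/exists_inPn multi] :=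
    boolP [exists v in A, #|S v| <= 1].
  exists v => //; have nbr_meet x : x \in neighbours A v -> S v :&: S x != set0.
    by rewrite inE adjE => /and3P[].
  move: Sv1; rewrite leq_eqVlt ltnS leqn0 cards_eq0.
  case/orP=> [/cards1P[i Sv]|/eqP Sv].
    have sub : neighbours A v \subset label_class i.
      apply/subsetP=> x /nbr_meet/set0Pn[j].
      by rewrite Sv !inE => /andP[/eqP->].
    split; last first.
      move=> x y /(subsetP sub) xi /(subsetP sub).
      exact: label_class_clique.
    by apply: nbr_le2 sub; rewrite // inE Sv inE.
  have nbr0 x : x \in neighbours A v = false.
    by apply/negP=> /nbr_meet; rewrite Sv set0I eqxx.
  by split=> [|x y]; rewrite ?nbr0 // eq_card0.
have {}multi x : x \in A -> 1 < #|S x| by move/multi; rewrite -ltnNge.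
exists v0 => //; split; last first.
  move=> x y; rewrite !inE => /andP[xA _] /andP[yA _]; rewrite adjE => ->.
  apply: contraTneq T3 => Sxy0; rewrite -ltnNge.
  apply: leq_trans (max_card (S x :|: S y)); rewrite cardsU Sxy0 cards0 subn0.
  by rewrite (leq_add (multi x xA) (multi y yA)).
apply: (nbr_le2 A) => //; last by apply/subsetP=> x; rewrite inE => /andP[].
have {}single := single (leq_trans (multi v0 v0A) (max_card _)).
have A_class i : #|A :&: label_class i| <= 2.
  have [x Sx] := single i; rewrite -ltnS; apply: leq_trans (class3 i).
  apply: proper_card; apply/properP; split; first exact: subsetIr.
  exists x; first by rewrite inE Sx set11.
  by rewrite inE; apply/negP=> /andP[/multi]; rewrite Sx cards1.
have count : \sum_(x in A) #|S x| = \sum_i #|A :&: label_class i|.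
  under eq_bigr => x _ do rewrite -sum1_card.
  rewrite (exchange_big_dep predT) //=; apply: eq_bigr => i _.
  by rewrite -sum1_card; apply: eq_bigl => x; rewrite !inE.
have : #|A| * 2 <= #|T| * 2.
  have -> : #|T| * 2 = \sum_(i : T) 2.
    by rewrite -sum_nat_const; apply: eq_bigl => i; rewrite inE.
  rewrite -sum_nat_const.
  apply: (@leq_trans (\sum_(x in A) #|S x|)); first exact: leq_sum.
  by rewrite count; apply: leq_sum.
by rewrite leq_pmul2r // => /leq_trans->.
Qed.

End LabelledGraph.

(** * Counting divisors *)

Lemma logn_part' q m : logn q m`_q^' = 0.
Proof.
have [q_pr|q_npr] := boolP (prime q); last by rewrite lognE (negPf q_npr).
by apply/logn_coprime; rewrite (pnat_coprime (pnat_id q_pr)) ?part_pnat.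
Qed.

(** These divisors are the products of [q ^ i], for [i < b], by a divisor of [m]
    prime to [q].  The greatest value allowed for [b] counts all the divisors
    of [m]. *)
Lemma size_divisors_not_pfactor q m b :
    prime q -> 0 < m -> b <= (logn q m).+1 ->
  size [seq d <- divisors m | ~~ (q ^ b %| d)] = b * size (divisors m`_q^').
Proof.
move=> q_pr m_gt0 le_b.
have logn_e e i : e \in divisors m`_q^' -> logn q (q ^ i * e) = i.
  rewrite -dvdn_divisors ?part_gt0 // => e_m.
  have e_gt0 := dvdn_gt0 (part_gt0 _ _) e_m.
  rewrite lognM ?expn_gt0 ?(prime_gt0 q_pr) // pfactorK //.
  have := dvdn_leq_log q (part_gt0 _ _) e_m.
  by rewrite logn_part' leqn0 => /eqP->; rewrite addn0.
rewrite -[b in RHS](size_iota 0) -(size_allpairs (fun i e => q ^ i * e)).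
apply/perm_size/uniq_perm; first by rewrite filter_uniq ?divisors_uniq.
  rewrite allpairs_uniq ?iota_uniq ?divisors_uniq // => -[i e] [j f].
  case/allpairsP=> -[i1 e1] [_ e1P [-> ->]].
  case/allpairsP=> -[j1 f1] [_ f1P [-> ->]] /= E.
  have ij : i1 = j1 by rewrite -(logn_e e1 i1) // E logn_e.
  move: E; rewrite ij => /eqP.
  by rewrite eqn_pmul2l ?expn_gt0 ?(prime_gt0 q_pr) // => /eqP->.
move=> d; rewrite mem_filter -dvdn_divisors //; apply/andP/allpairsP.
  move=> [q_d d_m]; have d_gt0 := dvdn_gt0 m_gt0 d_m.
  exists (logn q d, d`_q^'); split=> /=.
  - by rewrite mem_iota add0n /= ltnNge -pfactor_dvdn.
  - by rewrite -dvdn_divisors ?part_gt0 // partn_dvd.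
  - by rewrite -p_part partnC.
move=> [[i e] /= [i_b e_m ->]]; move: i_b; rewrite mem_iota add0n /= => i_b.
have := e_m; rewrite -dvdn_divisors ?part_gt0 // => e_dvd.
have e_gt0 := dvdn_gt0 (part_gt0 _ _) e_dvd; split.
  rewrite pfactor_dvdn ?muln_gt0 ?expn_gt0 ?(prime_gt0 q_pr) // logn_e //.
  by rewrite -ltnNge.
rewrite -[m](partnC q) // dvdn_mul // p_part dvdn_exp2l //.
by rewrite -ltnS (leq_trans i_b).
Qed.


Lemma dvdn_pfactor_part' q r k m : prime q -> prime r -> r != q -> 0 < m ->
  r ^ k %| m -> r ^ k %| m`_q^'.
Proof.
move=> q_pr r_pr rq m_gt0; rewrite -{1}(partnC q m_gt0) Gauss_dvdr // p_part.
by rewrite coprimeXl // coprimeXr // prime_coprime // dvdn_prime2.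
Qed.

Lemma logn_pfactorM q a k : prime q -> coprime q k -> logn q (q ^ a * k) = a.
Proof.
by move=> q_pr qk; rewrite mulnC logn_Gauss ?pfactorK // .
Qed.

Lemma partn_pfactorM q a k : prime q -> 0 < k -> coprime q k ->
  (q ^ a * k)`_q^' = k.
Proof.
move=> q_pr k_gt0 qk; rewrite partnM ?expn_gt0 ?(prime_gt0 q_pr) //.
rewrite part_p'nat ?pnatNK ?pnatX ?pnat_id // mul1n part_pnat_id //.
by rewrite p'natE // -prime_coprime.
Qed.

Lemma size_divisors_pfactorM q a k : prime q -> 0 < k -> coprime q k ->
  size (divisors (q ^ a * k)) = a.+1 * size (divisors k).
Proof.
move=> q_pr k_gt0 qk.
have m_gt0 : 0 < q ^ a * k by rewrite muln_gt0 expn_gt0 prime_gt0.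
have := @size_divisors_not_pfactor q (q ^ a * k) a.+1 q_pr m_gt0.
rewrite logn_pfactorM // partn_pfactorM // => <- //; congr size.
apply/esym/all_filterP/allP=> d; rewrite -dvdn_divisors // => d_m.
rewrite pfactor_dvdn ?(dvdn_gt0 m_gt0) // -ltnNge ltnS.
by have := dvdn_leq_log q m_gt0 d_m; rewrite logn_pfactorM.
Qed.

Lemma size_divisors_pfactor q a : prime q -> size (divisors (q ^ a)) = a.+1.
Proof.
move=> q_pr; rewrite -[q ^ a]muln1.
by rewrite size_divisors_pfactorM ?coprimen1 // muln1.
Qed.

Lemma size_divisors_gt1 k : 1 < k -> 1 < size (divisors k).
Proof.
move=> k1; apply: (@uniq_leq_size _ [:: 1; k]).
  by rewrite /= inE neq_ltn k1.
move=> d; rewrite !inE.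
by case/orP=> /eqP->; rewrite -dvdn_divisors ?dvd1n // ltnW.
Qed.

Lemma size_divisors_le2 k : 1 < k -> size (divisors k) <= 2 -> prime k.
Proof.
move=> k1; apply: contraTT => /primePn[|[d /andP[d1 dk] d_k]].
  by rewrite ltnNge k1.
rewrite -ltnNge; apply: (@uniq_leq_size _ [:: 1; d; k]).
  by rewrite /= !inE negb_or !neq_ltn k1 d1 dk.
move=> e; rewrite !inE -dvdn_divisors ?(ltnW k1) //.
by case/or3P=> /eqP->; rewrite ?dvd1n.
Qed.

(** Splitting off from [k] the full power [r ^ c] of a prime, the rest [k']
    satisfies [c.+1 * size (divisors k') <= 4]: if it is not [1], then [c] is
    [1] and [k'] has only two divisors. *)
Lemma size_divisors_le4 k : 0 < k -> size (divisors k) <= 4 ->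
  [\/ k = 1,
      exists r c, [/\ prime r, 0 < c & k = r ^ c]
    | exists r s, [/\ prime r, prime s, r != s & k = r * s]].
Proof.
move=> k_gt0; have [k1|] := leqP k 1.
  by move=> _; constructor 1; apply/eqP; rewrite eqn_leq k1.
move=> k1; have r_pr := pdiv_prime k1; set r := pdiv k in r_pr *.
have r_k' : coprime r k`_r^'.
  by rewrite prime_coprime // -p'natE ?part_pnat.
have c_gt0 : 0 < logn r k by rewrite logn_gt0 mem_primes r_pr k_gt0 pdiv_dvd.
have def_k : k = r ^ logn r k * k`_r^' by rewrite -p_part partnC.
rewrite {1}def_k size_divisors_pfactorM ?part_gt0 // => k_le4.
have [k'1|k'1] := leqP k`_r^' 1.
  constructor 2; exists r, (logn r k); split=> //; rewrite {1}def_k.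
  rewrite (_ : k`_r^' = 1) ?muln1 //.
  by apply/eqP; rewrite eqn_leq k'1 part_gt0.
have tau2 := size_divisors_gt1 k'1.
constructor 3; exists r, k`_r^'.
have s_pr : prime k`_r^'.
  apply: size_divisors_le2 => //.
  rewrite leqNgt; apply/negP=> tau3.
  by have := leq_trans (leq_mul (c_gt0 : 1 < (logn r k).+1) tau3) k_le4.
have c1 : logn r k = 1.
  by have := leq_trans (leq_mul (leqnn (logn r k).+1) tau2) k_le4; lia.
split=> //; last by rewrite {1}def_k c1.
by move: r_k'; rewrite prime_coprime // dvdn_prime2.
Qed.

Lemma dvdn_mul_primes r s k : prime r -> prime s -> r != s -> k %| r * s ->
  [\/ k = 1, k = r, k = s | k = r * s].
Proof.
move=> r_pr s_pr rs k_rs; have [r_k|r_k] := boolP (r %| k).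
  case/dvdnP: r_k k_rs => x ->; rewrite mulnC dvdn_pmul2l ?prime_gt0 //.
  case/primeP: s_pr => _ s_div /s_div/orP[]/eqP->; last by constructor 4.
  by rewrite muln1; constructor 2.
rewrite Gauss_dvdr ?(coprime_sym k) ?prime_coprime // in k_rs.
case/primeP: s_pr => _ s_div; case/orP: (s_div _ k_rs) => /eqP->.
  by constructor 1.
by constructor 3.
Qed.

(** * Ideals of [Z_m] and their products with [Z_n] *)

Section IdealsOfZm.
Local Open Scope ring_scope.
Variable m : nat.
Hypothesis m_gt1 : (1 < m)%N.
Implicit Types (d k : nat) (I : ideal_vertex 'Z_m).

Let m_gt0 : (0 < m)%N := ltnW m_gt1.

Lemma dvdn_Zp_nat d k : (d %| m)%N -> (d %| (k%:R : 'Z_m))%N = (d %| k)%N.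
Proof. by move=> d_m; rewrite val_Zp_nat // /dvdn modn_dvdm. Qed.

Definition multiples d : {set 'Z_m} := [set x : 'Z_m | d %| x]%N.

Lemma mem_multiples_nat d k :
  (d %| m)%N -> (k%:R \in multiples d) = (d %| k)%N.
Proof. by move=> d_m; rewrite inE dvdn_Zp_nat. Qed.

Lemma multiples_vertex d :
  (d %| m)%N -> d != 1%N -> d != m -> nonzero_proper_ideal (multiples d).
Proof.
move=> d_m d1 dm.
have d_ltm : (d < m)%N by rewrite ltn_neqAle dm dvdn_leq.
apply/nonzero_proper_idealP; split; first split.
- by rewrite inE dvdn0.
- by rewrite -[1]/(1%:R) mem_multiples_nat // dvdn1.
- move=> a u v; rewrite !inE => du dv.
  rewrite -[a]natr_Zp -[u]natr_Zp -[v]natr_Zp -natrM -natrD dvdn_Zp_nat //.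
  by rewrite dvdn_addr // dvdn_mull.
- apply/eqP=> /setP/(_ d%:R); rewrite mem_multiples_nat // dvdnn inE.
  move/esym/eqP/(congr1 val); rewrite /= val_Zp_nat // modn_small // => d0.
  by move: (dvdn_gt0 m_gt0 d_m); rewrite d0.
Qed.

(** Starting from [m], the greatest common divisor is the only divisor of [m]
    that generates [I], which makes the generator a complete invariant. *)
Definition generator I : nat := \big[gcdn/m]_(x in val I) (x : nat).

Lemma generator_dvd I : (generator I %| m)%N.
Proof.
apply: (big_rec (fun k => k %| m)%N) => // x k _.
exact/dvdn_trans/dvdn_gcdr.
Qed.

(** By Bezout, the greatest common divisor belongs to the ideal. *)
Lemma mem_idealE I (x : 'Z_m) : (x \in val I) = (generator I %| x)%N.
Proof.
have /nonzero_proper_idealP[[I0 _ Icl] _] := valP I.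
have Imul a u : u \in val I -> a * u \in val I.
  by move=> uI; rewrite -[_ * _]addr0 Icl.
have gI : (generator I)%:R \in val I.
  apply: (big_ind (fun k => k%:R \in val I)) => [|i j iI jI|a aI].
  - by rewrite pchar_Zp.
  - have [->|i_gt0] := posnP i; first by rewrite gcd0n.
    case: (egcdnP j i_gt0) => u v E _.
    have -> : (gcdn i j)%:R = u%:R * i%:R - v%:R * j%:R :> 'Z_m.
      by rewrite -!natrM E natrD addrC addKr.
    by apply: Icl => //; rewrite -mulNr Imul.
  - by rewrite natr_Zp.
apply/idP/idP=> [xI|/dvdnP[k xk]].
  rewrite /generator (bigD1 x) //=; exact: dvdn_gcdl.
by rewrite -[x]natr_Zp xk natrM Imul.
Qed.

Lemma val_idealE I : val I = multiples (generator I).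
Proof. by apply/setP=> x; rewrite mem_idealE inE. Qed.

Lemma generator_inj : injective generator.
Proof. by move=> I J E; apply: val_inj; rewrite !val_idealE E. Qed.

Lemma generator_neq1 I : generator I != 1%N.
Proof.
have /nonzero_proper_idealP[[_ I1 _] _] := valP I.
by apply: contraNneq I1 => g1; rewrite mem_idealE g1 dvd1n.
Qed.

Lemma generator_ltn I : (generator I < m)%N.
Proof.
rewrite ltn_neqAle dvdn_leq ?generator_dvd // andbT.
have /nonzero_proper_idealP[[I0 _ _] In0] := valP I.
apply: contraNneq In0 => gm; apply/eqP/setP=> x; rewrite inE mem_idealE gm.
apply/idP/eqP=> [m_x|->]; last by rewrite dvdn0.
move: m_x; rewrite /dvdn modn_small => [/eqP x0|]; first exact: val_inj.
by rewrite -[X in (_ < X)%N]Zp_cast.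
Qed.

Lemma generator_multiples d (Id : nonzero_proper_ideal (multiples d)) :
  (d %| m)%N -> generator (Sub (multiples d) Id) = d.
Proof.
move=> d_m; apply/eqP; rewrite eqn_dvd; apply/andP; split.
  rewrite -(dvdn_Zp_nat d (generator_dvd _)) -mem_idealE SubK.
  by rewrite mem_multiples_nat.
apply: (big_ind (fun k => d %| k)%N) => // [i j di dj|x].
  by rewrite dvdn_gcd di.
by rewrite SubK inE.
Qed.

Lemma vertex_of_divisor d : (d %| m)%N -> d != 1%N -> d != m ->
  exists I, generator I = d.
Proof.
move=> d_m d1 dm.
by exists (Sub _ (multiples_vertex d_m d1 dm)); apply: generator_multiples.
Qed.

Section IdealTimesZn.
Variable n : nat.
Hypothesis n_gt1 : (1 < n)%N.
Variable hmod : is_natural_module m n.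
Local Notation Zn := (Zn_module hmod).

Let n_m : (n %| m)%N. Proof. exact/is_natural_moduleP. Qed.

Lemma ideal_mul_nat I k : (generator I %| k)%N ->
  (k%:R : 'Z_n) \in ideal_mul Zn (val I).
Proof.
case/dvdnP=> j ->; apply/ideal_mulP; first exact: valP.
exists [:: ((generator I)%:R, (j%:R : 'Z_n) : Zn)].
  by rewrite /= mem_idealE dvdn_Zp_nat ?generator_dvd // dvdnn.
rewrite big_seq1 /= /GRing.scale /= /natural_action.
by rewrite val_Zp_nat // modn_small ?generator_ltn // -mulrnA.
Qed.

(** The restriction to divisors of [n] is what makes divisibility of a class
    modulo [n] meaningful. *)
Lemma ideal_mul_dvd e I (y : 'Z_n) : (e %| n)%N -> (e %| generator I)%N ->
  y \in ideal_mul Zn (val I) -> (e %| y)%N.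
Proof.
move=> e_n e_I /(ideal_mulP _ (valP I))[s sI ->].
have dvd_nat k : (e %| (k%:R : 'Z_n))%N = (e %| k)%N.
  by rewrite val_Zp_nat // /dvdn modn_dvdm.
rewrite big_seq; apply: (big_ind (fun y : 'Z_n => e %| y)%N)
  => [|x z ex ez|[a x] /(allP sI)].
- by rewrite dvdn0.
- by rewrite -[x]natr_Zp -[z]natr_Zp -natrD dvd_nat dvdn_add.
- rewrite /= mem_idealE => /(dvdn_trans e_I) e_a.
  rewrite /GRing.scale /= /natural_action -[x]natr_Zp -mulrnA dvd_nat.
  by rewrite dvdn_mull.
Qed.

(** When every [n`_q] divides one of the two generators, an element of the
    intersection is divisible by every [n`_q], hence by [n].  Otherwise the
    least common multiple of the generators is not divisible by some [n`_q],
    and its class in the intersection is not zero. *)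
Lemma ideal_mul_meet (I J : ideal_vertex 'Z_m) :
  (ideal_mul Zn (val I) :&: ideal_mul Zn (val J) != [set 0]) =
  has (fun q : nat =>
         ~~ (n`_q %| generator I)%N && ~~ (n`_q %| generator J)%N) (primes n).
Proof.
have n_gt0 := ltnW n_gt1.
have gen_gt0 K := dvdn_gt0 m_gt0 (generator_dvd K).
have in0 (K : ideal_vertex _) : 0 \in ideal_mul Zn (val K).
  by apply/ideal_mulP; [apply: valP | exists [::]; rewrite ?big_nil].
apply/idP/hasP=> [meet|[q q_n /andP[qI qJ]]].
  apply/hasP; apply: contraNT meet => /hasPn no_q.
  apply/eqP/setP=> y; rewrite !inE.
  apply/andP/eqP=> [[yI yJ]|->]; last by rewrite !in0.
  suff n_y : (n %| (y : 'Z_n))%N.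
    rewrite -[y : 'Z_n]natr_Zp; case/dvdnP: n_y => k ->.
    by rewrite natrM pchar_Zp // mulr0.
  apply/dvdn_partP=> // q q_n; have := no_q q; rewrite negb_and !negbK.
  case/(_ q_n)/orP=> [qI|qJ];
    [apply: ideal_mul_dvd yI | apply: ideal_mul_dvd yJ]; by rewrite ?dvdn_part.
have q_pr : prime q by move: q_n; rewrite mem_primes => /andP[].
pose l := lcmn (generator I) (generator J).
have : (l%:R : 'Z_n) \in ideal_mul Zn (val I) :&: ideal_mul Zn (val J).
  by rewrite inE !ideal_mul_nat ?dvdn_lcml ?dvdn_lcmr.
apply: contraTneq => ->; rewrite inE; apply/eqP=> /(congr1 val).
rewrite /= val_Zp_nat // => /eqP n_l.
have := dvdn_trans (dvdn_part q n) n_l; apply/negP.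
move: qI qJ; rewrite p_part !pfactor_dvdn ?lcmn_gt0 ?gen_gt0 // -!ltnNge.
by rewrite logn_lcm // gtn_max => -> ->.
Qed.

(** The primes [q] for which the product of the ideal by the [q]-primary
    component of [Z_n] is not zero. *)
Definition deficient_primes I : {set seq_sub (primes n)} :=
  [set q : seq_sub (primes n) | ~~ (n`_(ssval q : nat) %| generator I)%N].

Lemma intersection_adjE (I J : intersection_graph Zn) :
  adj I J = (I != J) && (deficient_primes I :&: deficient_primes J != set0).
Proof.
rewrite /= /intersection_adj ideal_mul_meet; congr (_ && _).
apply/hasP/set0Pn=> [[q q_n qIJ]|[q]].
  by exists (SeqSub q_n); rewrite !inE.
by rewrite !inE => qIJ; exists (ssval q) => //; apply: valP.
Qed.

End IdealTimesZn.
End IdealsOfZm.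

(** * Ring graphs and the number of divisors *)

Definition deficiency_count m n q := logn q n * size (divisors m`_q^').

Section Criterion.
Variables m n : nat.
Hypotheses (m_gt1 : 1 < m) (n_gt1 : 1 < n).
Variable hmod : is_natural_module m n.

Let m_gt0 : 0 < m := ltnW m_gt1.
Let n_gt0 : 0 < n := ltnW n_gt1.
Let n_m : n %| m. Proof. exact/is_natural_moduleP. Qed.
Local Notation G := (@intersection_graph 'Z_m (Zn_module hmod)).

(** The successor accounts for the divisor [1], which generates no proper ideal;
    the divisor [m] is not counted, being divisible by [n`_q]. *)
Lemma card_deficient_ideals (q : seq_sub (primes n)) :
  #|@label_class G _ (@deficient_primes m n) q|.+1 =
    deficiency_count m n (ssval q).
Proof.
case: q => q /= q_n; have [q_pr _ q_dvd] : [/\ prime q, 0 < n & q %| n].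
  by move: q_n; rewrite mem_primes => /and3P[].
rewrite /deficiency_count -size_divisors_not_pfactor //; last first.
  by apply/leqW/dvdn_leq_log.
set C := label_class _ _.
rewrite cardE -(size_map (@generator m)) -[_.+1]/(size (1 :: map _ _)).
apply/perm_size/uniq_perm.
- rewrite cons_uniq (map_inj_uniq (generator_inj m_gt1)) enum_uniq andbT.
  by apply/mapP=> -[I _ /esym/eqP]; apply/negP/generator_neq1.
- by rewrite filter_uniq ?divisors_uniq.
move=> d; rewrite mem_filter -dvdn_divisors // inE -p_part.
apply/orP/andP=> [[/eqP->|/mapP[I]]|[q_d d_m]].
- by rewrite dvdn1 p_part_eq1 negbK q_n dvd1n.
- by rewrite mem_enum !inE /= => qI ->; rewrite qI generator_dvd.
have [->|d1] := eqVneq d 1; [by left | right].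
have dm : d != m.
  by apply: contraNneq q_d => ->; apply: dvdn_trans (dvdn_part _ _) n_m.
have [I gI] := vertex_of_divisor m_gt1 d_m d1 dm.
by apply/mapP; exists I; rewrite // mem_enum !inE /= gI.
Qed.

(** If [p], [q], [r] and [s] divide [n], then [1], [q], [r], [s] and [q * r] are
    five divisors of [m] prime to [p]. *)
Lemma deficiency_count_primes :
  {in primes n, forall q, deficiency_count m n q <= 4} -> size (primes n) <= 3.
Proof.
move=> le4; rewrite leqNgt; apply/negP=> n4.
have := primes_uniq n.
have pr q : q \in primes n -> prime q /\ q %| m.
  by rewrite mem_primes => /and3P[-> _ /dvdn_trans->].
case def_n : (primes n) n4 => [|p [|q [|r [|s t]]]] // _.
have [p_n q_n r_n s_n] :
    [/\ p \in primes n, q \in primes n, r \in primes n & s \in primes n].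
  by rewrite def_n !inE !eqxx !orbT.
rewrite /= !inE !negb_or.
case/and4P=> /and4P[p_q p_r p_s _] /and3P[qr qs _] /andP[rs _] _.
have [[p_pr _] [q_pr q_m] [r_pr r_m] [s_pr s_m]] :
    [/\ prime p /\ p %| m, prime q /\ q %| m,
        prime r /\ r %| m & prime s /\ s %| m].
  by split; apply: pr.
have := le4 p p_n; apply/negP; rewrite -ltnNge.
have dvd u : prime u -> p != u -> u %| m -> u %| m`_p^'.
  by move=> u_pr pu um; rewrite -[u]expn1 dvdn_pfactor_part' // eq_sym.
have qr_m : q * r %| m`_p^'.
  by rewrite Gauss_dvd ?dvd // prime_coprime // dvdn_prime2.
have : size [:: 1; q; r; s; q * r] <= size (divisors m`_p^').
  apply: uniq_leq_size => [|d].
    have neq1 u : prime u -> 1 != u by case: u => [|[]].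
    have q_qr : q != q * r by rewrite -{1}[q]muln1 eqn_pmul2l ?prime_gt0 ?neq1.
    have r_qr : r != q * r by rewrite -{1}[r]mul1n eqn_pmul2r ?prime_gt0 ?neq1.
    have s_qr : s != q * r.
      by apply: contraNneq qs => sE; rewrite -dvdn_prime2 // sE dvdn_mulr.
    have qr1 : 1 != q * r by rewrite eq_sym muln_eq1 negb_and eq_sym neq1.
    by rewrite /= !inE !negb_or qr1 !neq1 // qr qs rs q_qr r_qr s_qr.
  rewrite !inE -dvdn_divisors ?part_gt0 // => /or4P[||| /orP[]] /eqP-> //;
    first [exact: dvd1n | exact: dvd].
move=> /leq_trans-> //; by rewrite leq_pmull ?logn_gt0.
Qed.

(** The ideal is generated by the largest divisor of [m] prime to [q], which is
    not [1] since another prime divides [n]. *)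
Lemma deficient_singleton (q : seq_sub (primes n)) : 1 < size (primes n) ->
  exists I : G, deficient_primes n I = [set q].
Proof.
case: q => q q_n n2; have [q_pr _ q_dvd] : [/\ prime q, 0 < n & q %| n].
  by move: q_n; rewrite mem_primes => /and3P[].
have [r r_n rq] : exists2 r, r \in primes n & r != q.
  apply/hasP; apply: contraTT n2; rewrite -all_predC -leqNgt => /allP all_q.
  apply: (@uniq_leq_size _ (primes n) [:: q]); rewrite ?primes_uniq // => r r_n.
  by rewrite inE; have:= all_q r r_n; rewrite /= negbK.
have pr u : u \in primes n -> prime u by rewrite mem_primes => /andP[].
have dvd_r u : u \in primes n -> u != q -> n`_u %| m`_q^'.
  move=> u_n uq; rewrite p_part dvdn_pfactor_part' ?pr // -p_part.
  exact: dvdn_trans (dvdn_part _ _) n_m.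
have [|||I gI] := @vertex_of_divisor m m_gt1 m`_q^'; first exact: dvdn_part.
- apply: contraTneq (dvd_r r r_n rq) => ->.
  by rewrite dvdn1 p_part_eq1 negbK.
- apply/eqP=> /(congr1 (logn q)); rewrite logn_part' => /esym/eqP.
  rewrite -leqn0 leqNgt logn_gt0 mem_primes q_pr m_gt0.
  by rewrite (dvdn_trans q_dvd n_m).
exists I; apply/setP=> -[u u_n]; rewrite !inE gI /= -val_eqE /=.
have [->|uq] := eqVneq u q; last by rewrite dvd_r.
by rewrite p_part pfactor_dvdn ?part_gt0 // logn_part' -ltnNge logn_gt0.
Qed.

Lemma ring_graph_deficiency_count :
  ring_graph G <-> {in primes n, forall q, deficiency_count m n q <= 4}.
Proof.
have adjE (I J : G) := intersection_adjE m_gt1 n_gt1 I J.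
split=> [ringG q q_n|le4].
  rewrite -(card_deficient_ideals (SeqSub q_n)) ltnS.
  exact/(ring_graph_clique_le3 ringG)/label_class_clique.
have T_size : #|{: seq_sub (primes n)}| = size (primes n).
  exact/card_seq_sub/primes_uniq.
apply/elimination_ring_graph/(label_elimination adjE) => [|q|].
- by rewrite T_size deficiency_count_primes.
- by rewrite -ltnS card_deficient_ideals le4 // (valP q).
- by rewrite T_size => T2 q; apply: deficient_singleton.
Qed.

End Criterion.

(** * Solving the inequalities *)

Lemma deficiency_countE q a m b n : prime q -> 0 < m -> coprime q m ->
  coprime q n ->
  deficiency_count (q ^ a * m) (q ^ b * n) q = b * size (divisors m).
Proof.
by move=> *; rewrite /deficiency_count logn_pfactorM // partn_pfactorM.
Qed.

Lemma third_prime p q : exists r, [/\ prime r, p != r & q != r].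
Proof.
have [r pq_r r_pr] := prime_above (p + q); exists r.
rewrite !neq_ltn (leq_ltn_trans (leq_addr q p)) //.
by rewrite (leq_ltn_trans (leq_addl p q)).
Qed.

Lemma mul_succ_le4 b c : 0 < b -> 0 < c -> b * c.+1 <= 4 ->
  (b = 1 /\ c <= 3) \/ (b = 2 /\ c = 1).
Proof. by case: b => [|[|[|b]]] //; case: c => [|[|c]] // _ _; lia. Qed.

Definition ring_graph_pair (m n : nat) : Prop :=
  exists p1 p2 p3 a1 a2 b1 : nat,
    [/\ prime p1, prime p2, prime p3 & uniq [:: p1; p2; p3]] /\
    [/\ 0 < a1, 0 < a2 & 0 < b1] /\
    ([/\ m = p1 ^ a1, n = p1 ^ b1 & b1 <= 4] \/
     [/\ m = p1 ^ a1 * p2 ^ a2, n = p1 & a2 <= 3] \/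
     (m = p1 ^ a1 * p2 /\ n = p1 ^ 2) \/
     (m = p1 ^ a1 * p2 * p3 /\ n = p1) \/
     [/\ m = p1 * p2 ^ a2, n = p1 * p2 ^ 2 & a2 = 2 \/ a2 = 3] \/
     (m = p1 * p2 * p3 /\ n = p1 * p2) \/
     [/\ m = p1 ^ a1 * p2 ^ a2, n = p1 * p2, a1 <= 3 & a2 <= 3] \/
     (m = p1 * p2 * p3 /\ n = p1 * p2 * p3)).

Lemma deficiency_count_pair m n : ring_graph_pair m n ->
  {in primes n, forall q, deficiency_count m n q <= 4}.
Proof.
case=> [p1 [p2 [p3 [a1 [a2 [b1 [[pr1 pr2 pr3]]]]]]]].
rewrite /= !inE !negb_or andbT => /andP[/andP[p12 p13] p23].
case=> [[a1_gt0 a2_gt0 b1_gt0] cases].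
have cop p q : prime p -> prime q -> p != q -> coprime p q /\ coprime q p.
  by move=> *; rewrite (coprime_sym q) prime_coprime // dvdn_prime2.
have [c12 c21] := cop _ _ pr1 pr2 p12.
have [c13 c31] := cop _ _ pr1 pr3 p13.
have [c23 c32] := cop _ _ pr2 pr3 p23.
have [g1 g2 g3] : [/\ 0 < p1, 0 < p2 & 0 < p3] by rewrite !prime_gt0.
have tau1 p : prime p -> size (divisors p) = 2.
  by move=> /(size_divisors_pfactor 1).
have tau2 p q : prime p -> prime q -> coprime p q ->
    size (divisors (p * q)) = 4.
  move=> pp qp pq; rewrite -[p]expn1.
  by rewrite size_divisors_pfactorM ?prime_gt0 // tau1.
have count q a m' b n' : prime q -> 0 < m' -> coprime q m' -> coprime q n' ->
    m = q ^ a * m' -> n = q ^ b * n' -> b * size (divisors m') <= 4 ->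
    deficiency_count m n q <= 4.
  by move=> q_pr m'_gt0 qm qn -> ->; rewrite deficiency_countE.
move=> q; rewrite mem_primes => /and3P[q_pr _].
have is_base p a : prime p -> q %| p ^ a -> q = p.
  by move=> p_pr; rewrite Euclid_dvdX // dvdn_prime2 // => /andP[/eqP].
have is_prime p : prime p -> q %| p -> q = p.
  by move=> p_pr; apply: (is_base p 1).
case: cases => [[Em En b1_le]|[[Em En a2_le]|[[Em En]|[[Em En]|
  [[Em En a2_23]|[[Em En]|[[Em En a1_le a2_le]|[Em En]]]]]]]].
- rewrite {1}En => /is_base->//.
  by apply: (count p1 a1 1 b1 1); rewrite ?mul1n ?muln1 ?coprimen1.
- rewrite {1}En => /is_prime->//.
  apply: (count p1 a1 (p2 ^ a2) 1 1);
    rewrite ?mul1n ?muln1 ?coprimen1 ?coprimeXr ?expn_gt0 ?g2;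
    by rewrite ?size_divisors_pfactor.
- rewrite {1}En => /is_base->//.
  by apply: (count p1 a1 p2 2 1); rewrite ?mul1n ?muln1 ?coprimen1 ?tau1.
- rewrite {1}En => /is_prime->//.
  apply: (count p1 a1 (p2 * p3) 1 1);
    rewrite ?mulnA ?mul1n ?muln1 ?coprimen1 ?coprimeMr ?c12 ?muln_gt0 ?g2;
    by rewrite ?tau2.
- rewrite {1}En Euclid_dvdM // => /orP[/is_prime->//|/is_base->//].
    apply: (count p1 1 (p2 ^ a2) 1 (p2 ^ 2));
      rewrite ?coprimeXr ?expn_gt0 ?g2 ?size_divisors_pfactor //.
    by case: a2_23 => ->.
  by apply: (count p2 a2 p1 2 p1); rewrite ?tau1 // mulnC.
- rewrite {1}En Euclid_dvdM // => /orP[/is_prime->//|/is_prime->//].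
    apply: (count p1 1 (p2 * p3) 1 p2);
      by rewrite ?mul1n ?coprimeMr ?c12 ?muln_gt0 ?g2 ?tau2 ?mulnA.
  apply: (count p2 1 (p1 * p3) 1 p1);
    rewrite ?mul1n ?coprimeMr ?c21 ?muln_gt0 ?g1 ?tau2 ?Em ?En //;
    by rewrite ?mulnA ?(mulnC p1).
- rewrite {1}En Euclid_dvdM // => /orP[/is_prime->//|/is_prime->//].
    apply: (count p1 a1 (p2 ^ a2) 1 p2);
      by rewrite ?mul1n ?coprimeXr ?expn_gt0 ?g2 ?size_divisors_pfactor.
  apply: (count p2 a2 (p1 ^ a1) 1 p1);
    by rewrite ?mul1n ?coprimeXr ?expn_gt0 ?g1 ?size_divisors_pfactor // mulnC.
- rewrite {1}En !Euclid_dvdM // -orbA.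
  case/or3P=> [/is_prime->//|/is_prime->//|/is_prime->//].
  + apply: (count p1 1 (p2 * p3) 1 (p2 * p3));
      by rewrite ?mul1n ?coprimeMr ?c12 ?muln_gt0 ?g2 ?tau2 ?mulnA.
  + apply: (count p2 1 (p1 * p3) 1 (p1 * p3));
      rewrite ?mul1n ?coprimeMr ?c21 ?muln_gt0 ?g1 ?tau2 ?Em ?En //;
      by rewrite ?mulnA ?(mulnC p1).
  + apply: (count p3 1 (p1 * p2) 1 (p1 * p2));
      by rewrite ?mul1n ?coprimeMr ?c31 ?muln_gt0 ?g1 ?tau2 ?Em ?En // mulnC.
Qed.

(** For the least prime [q] of [n], the inequality bounds the number of divisors
    of the part [m'] of [m] prime to [q], which leaves [1], [r ^ c] or [r * s].
    The exponent of [q] in [m] is bounded only when another prime divides [n],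
    by the inequality for that prime. *)
Lemma pair_of_deficiency_count m n : 1 < m -> 1 < n -> n %| m ->
  {in primes n, forall q, deficiency_count m n q <= 4} -> ring_graph_pair m n.
Proof.
move=> m1 n1 n_m le4.
have q_pr := pdiv_prime n1; set q := pdiv n in q_pr.
have m_gt0 := ltnW m1; have n_gt0 := ltnW n1.
have q_n : q \in primes n by rewrite mem_primes q_pr n_gt0 pdiv_dvd.
have b_gt0 : 0 < logn q n by rewrite logn_gt0.
have ba := dvdn_leq_log q m_gt0 n_m.
have def_m : m = q ^ logn q m * m`_q^' by rewrite -p_part partnC.
have def_n : n = q ^ logn q n * n`_q^' by rewrite -p_part partnC.
have cop k : coprime q k`_q^' by rewrite prime_coprime // -p'natE ?part_pnat.
have qm' := cop m; have qn' := cop n.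
have m'_gt0 : 0 < m`_q^' by exact: part_gt0.
have n'_m' : n`_q^' %| m`_q^' by apply: partn_dvd.
have le4q : logn q n * size (divisors m`_q^') <= 4 by exact: le4.
move: (logn q m) (logn q n) m`_q^' n`_q^' def_m def_n qm' qn' b_gt0 ba
  m'_gt0 n'_m' le4q.
move=> a b m' n' def_m def_n qm' qn' b_gt0 ba m'_gt0 n'_m' le4q.
have neq_of_cop r k : prime r -> coprime q (r * k) -> q != r.
  move=> r_pr; rewrite coprimeMr => /andP[qr _].
  by move: qr; rewrite prime_coprime // dvdn_prime2.
have tau_m' : size (divisors m') <= 4.
  by apply: leq_trans le4q; rewrite leq_pmull.
have a_gt0 : 0 < a := leq_trans b_gt0 ba.
have [m'1|[r [c [r_pr c_gt0 def_m']]]|[r [s [r_pr s_pr rs def_m']]]] :=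
    size_divisors_le4 m'_gt0 tau_m'.
- have [r [r_pr qr _]] := third_prime q q.
  have [s [s_pr qs rs]] := third_prime q r.
  exists q, r, s, a, 1, b;
    do 2!(split; first by rewrite /= ?inE ?negb_or ?qr ?qs ?rs).
  left; split; last by move: le4q; rewrite m'1 muln1.
    by rewrite def_m m'1 muln1.
  by move: n'_m'; rewrite m'1 dvdn1 => /eqP n'1; rewrite def_n n'1 muln1.
- have qr : q != r.
    by move: qm'; rewrite def_m' coprime_pexpr // prime_coprime // dvdn_prime2.
  have [s [s_pr qs rs]] := third_prime q r.
  have tau_c : b * c.+1 <= 4.
    by move: le4q; rewrite def_m' size_divisors_pfactor.
  have /(dvdn_pfactor _ _ r_pr)[g g_c def_n'] : n' %| r ^ c by rewrite -def_m'.
  have [g0|g_gt0] := posnP g.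
    exists q, r, s, a, c, b;
      do 2!(split; first by rewrite /= ?inE ?negb_or ?qr ?qs ?rs).
    rewrite def_m def_n def_m' def_n' g0 muln1; right.
    have [[b1 c_le]|[b2 c1]] := mul_succ_le4 b_gt0 c_gt0 tau_c.
      by left; rewrite b1.
    by right; left; rewrite b2 c1.
  have r_n : r \in primes n.
    by rewrite mem_primes r_pr n_gt0 def_n def_n' dvdn_mull // dvdn_exp.
  have tau_a : g * a.+1 <= 4.
    have := le4 r r_n; rewrite def_m def_n def_m' def_n' ![q ^ _ * _]mulnC.
    rewrite deficiency_countE ?expn_gt0 ?(prime_gt0 q_pr) //;
      rewrite ?size_divisors_pfactor //;
      by rewrite coprimeXr // prime_coprime // dvdn_prime2 // eq_sym.
  have three_or_two x : 1 < x -> x <= 3 -> x = 2 \/ x = 3.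
    by case: x => [|[|[|[|x]]]] // _ _; [left | right].
  have [[b1 c_le]|[b2 c1]] := mul_succ_le4 b_gt0 c_gt0 tau_c;
    have [[g1 a_le]|[g2 a1]] := mul_succ_le4 g_gt0 a_gt0 tau_a.
  + exists q, r, s, a, c, b;
      do 2!(split; first by rewrite /= ?inE ?negb_or ?qr ?qs ?rs).
    by do 6!right; left; rewrite def_m def_n def_m' def_n' b1 g1.
  + exists q, r, s, a, c, b;
      do 2!(split; first by rewrite /= ?inE ?negb_or ?qr ?qs ?rs).
    do 4!right; left; rewrite def_m def_n def_m' def_n' b1 g2 a1; split=> //.
    by apply: three_or_two c_le; rewrite -g2.
  + exists r, q, s, c, a, b;
      do 2!(split; first by rewrite /= ?inE ?negb_or ?(eq_sym r q) ?qr ?qs ?rs).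
    do 4!right; left; rewrite def_m def_n def_m' def_n' b2 c1 g1.
    split; rewrite 1?mulnC //; apply: three_or_two a_le; by rewrite -b2.
  + by rewrite a1 b2 in ba.
have [qr qs] : q != r /\ q != s.
  by split; [apply: (neq_of_cop r s) | apply: (neq_of_cop s r)];
    rewrite // -?def_m' // mulnC -def_m'.
have tau_m'4 : size (divisors m') = 4.
  rewrite def_m' -[r]expn1 size_divisors_pfactorM ?prime_gt0 //.
    by rewrite (size_divisors_pfactor 1).
  by rewrite prime_coprime // dvdn_prime2.
have b1 : b = 1.
  apply/eqP; rewrite eqn_leq b_gt0 andbT.
  by rewrite -(leq_pmul2r (ltn0Sn 3)) -{1}tau_m'4.
(* The inequality for a prime [u] dividing [n] other than [q]: the part of [m]
   prime to [u] is [q ^ a * v], which has [2 * a.+1] divisors. *)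
have a1 u v l : prime u -> prime v -> u != v -> q != u -> q != v ->
    r * s = u * v -> coprime u l -> n = u * l -> a = 1.
  move=> u_pr v_pr uv qu qv rs_uv ul n_ul.
  have u_n : u \in primes n by rewrite mem_primes u_pr n_gt0 n_ul dvdn_mulr.
  have cop2 x y : prime x -> prime y -> x != y -> coprime x y.
    by move=> *; rewrite prime_coprime // dvdn_prime2.
  have := le4 u u_n.
  have -> : m = u ^ 1 * (q ^ a * v) by rewrite def_m def_m' rs_uv expn1 mulnCA.
  rewrite n_ul -[X in deficiency_count _ (X * _)]expn1 deficiency_countE //.
  - rewrite size_divisors_pfactorM ?prime_gt0 ?cop2 //.
    rewrite (size_divisors_pfactor 1) // mul1n (@leq_pmul2r 2 a.+1 2) //.
    by move=> a_le1; apply/eqP; rewrite eqn_leq a_gt0 andbT.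
  - by rewrite muln_gt0 expn_gt0 !prime_gt0.
  - by rewrite coprimeMr coprimeXr ?cop2 // eq_sym.
have n'_rs : n' %| r * s by rewrite -def_m'.
have [n'1|n'r|n's|n'rs] := dvdn_mul_primes r_pr s_pr rs n'_rs.
- exists q, r, s, a, 1, 1;
    do 2!(split; first by rewrite /= ?inE ?negb_or ?qr ?qs ?rs).
  by do 3!right; left; rewrite def_m def_n def_m' n'1 b1 muln1 mulnA.
- have a_1 : a = 1.
    apply: (a1 r s q) => //.
      by rewrite prime_coprime // dvdn_prime2 // eq_sym.
    by rewrite def_n b1 n'r mulnC.
  exists q, r, s, a, 1, 1;
    do 2!(split; first by rewrite /= ?inE ?negb_or ?qr ?qs ?rs).
  by do 5!right; left; rewrite def_m def_n def_m' n'r b1 a_1 mulnA.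
- have a_1 : a = 1.
    apply: (a1 s r q) => //; first by rewrite eq_sym.
    + by rewrite mulnC.
    + by rewrite prime_coprime // dvdn_prime2 // eq_sym.
    + by rewrite def_n b1 n's mulnC.
  exists q, s, r, a, 1, 1;
    do 2!(split; first by rewrite /= ?inE ?negb_or ?qr ?qs 1?eq_sym ?rs).
  by do 5!right; left; rewrite def_m def_n def_m' n's b1 a_1 (mulnC r) mulnA.
- have a_1 : a = 1.
    apply: (a1 r s (q * s)) => //.
      by rewrite coprimeMr !prime_coprime // !dvdn_prime2 // eq_sym qr.
    by rewrite def_n b1 n'rs mulnCA.
  exists q, r, s, a, 1, 1;
    do 2!(split; first by rewrite /= ?inE ?negb_or ?qr ?qs ?rs).
  by do 7!right; rewrite def_m def_n def_m' n'rs b1 a_1 !mulnA.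
Qed.

Theorem theorem2 (m n : nat) (hm : 1 < m) (hn : 1 < n)
    (hmod : is_natural_module m n) :
  ring_graph (@intersection_graph 'Z_m (Zn_module hmod)) <->
  exists p1 p2 p3 a1 a2 b1 : nat,
    [/\ prime p1, prime p2, prime p3 & uniq [:: p1; p2; p3]] /\
    [/\ 0 < a1, 0 < a2 & 0 < b1] /\
    ([/\ m = p1 ^ a1, n = p1 ^ b1 & b1 <= 4] \/
     [/\ m = p1 ^ a1 * p2 ^ a2, n = p1 & a2 <= 3] \/
     (m = p1 ^ a1 * p2 /\ n = p1 ^ 2) \/
     (m = p1 ^ a1 * p2 * p3 /\ n = p1) \/
     [/\ m = p1 * p2 ^ a2, n = p1 * p2 ^ 2 & a2 = 2 \/ a2 = 3] \/
     (m = p1 * p2 * p3 /\ n = p1 * p2) \/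
     [/\ m = p1 ^ a1 * p2 ^ a2, n = p1 * p2, a1 <= 3 & a2 <= 3] \/
     (m = p1 * p2 * p3 /\ n = p1 * p2 * p3)).
Proof.
have n_m : n %| m := (is_natural_moduleP hm hn).1 hmod.
split=> [/(ring_graph_deficiency_count hm hn)|pair].
  exact: pair_of_deficiency_count.
exact/(ring_graph_deficiency_count hm hn)/deficiency_count_pair.
Qed.
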